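(* Let $G$ be a convex bipartite graph with bipartition $(X,Y)$ and convex ordering $X=(x_1,\ldots,x_n)$. Then $G$ has a Hamiltonian cycle if and only if $G$ satisfies Property A.
   Context: All graphs are finite, simple, connected and unweighted. A convex bipartite graph is a bipartite graph $G$ with bipartition $(X,Y)$ together with an ordering $X=(x_1,\ldots,x_n)$ such that for every $y\in Y$ the neighborhood $N_G(y)$ consists of consecutive vertices $\{x_i,x_{i+1},\ldots,x_j\}$ of this ordering; $n=|X|$. For $1\le p<q\le n$ let $X_{p..q}=\{x_p,\ldots,x_q\}$, $N_G[X_{p..q}]=\{y\in Y : N_G(y)\subseteq X_{p..q}\}$ and $N'_G[X_{p..q}]=\{y\in Y : |N_G(y)\cap X_{p..q}|\ge 2\}$. $G$ satisfies Property A if: (1) (upper bound) for all $1\le p<q\le n$ with $(p,q)\neq(1,n)$, $|N_G[X_{p..q}]|\le q-p$; (2) (lower bound) for every integer $j\in\{1,\ldots,n-1\}$ and all indices with $1\le p_1<q_1\le p_2<q_2\le\cdots\le p_j<q_j\le n$, $\left|\bigcup_{i=1}^j N'_G[X_{p_i..q_i}]\right|\ge\sum_{i=1}^j (q_i-p_i)$; (3) (cardinality bound) $|N_G[X_{1..n}]|=|N'_G[X_{1..n}]|=n$. *)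

(* Defs.v *)
From mathcomp Require Import all_boot.

Set Implicit Arguments.
Unset Strict Implicit.
Unset Printing Implicit Defensive.

Section Graphs.

Variables (V : finType) (e : rel V).

(* The null graph does not count as connected. *)
Definition connected_graph : Prop :=
  0 < #|V| /\ forall u v : V, connect e u v.

Definition simple_connected_graph : Prop :=
  [/\ symmetric e, irreflexive e & connected_graph].

Definition nbhd (v : V) : {set V} := [set u | e v u].

Definition bipartition (X Y : {set V}) : Prop :=
  [/\ X :|: Y = [set: V], [disjoint X & Y] &
      forall u v, e u v ->
        (u \in X) && (v \in Y) || (u \in Y) && (v \in X)].

(* In a simple graph a cycle has at least three vertices; [ucycle] alone
   would also accept the empty sequence and a single edge traversed twice. *)
Definition has_hamiltonian_cycle : Prop :=
  exists c : seq V, [/\ 2 < size c, ucycle e c & forall v, v \in c].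

Variables (X Y : {set V}) (n : nat) (x : 'I_n -> V).

(* Positions are counted from 1: the vertex written x_k is [x] at the ordinal
   of value k - 1, and [segment p q] is {x_p, ..., x_q}. *)
Definition segment (p q : nat) : {set V} :=
  [set x i | i : 'I_n & p <= i.+1 <= q].

Definition convex_ordering : Prop :=
  [/\ injective x, X = [set x i | i : 'I_n] &
      forall y, y \in Y -> exists i j, nbhd y = segment i j].

Definition convex_bipartite : Prop :=
  [/\ simple_connected_graph, bipartition X Y & convex_ordering].

Definition Nin (p q : nat) : {set V} :=
  [set y in Y | nbhd y \subset segment p q].

Definition Nmeet (p q : nat) : {set V} :=
  [set y in Y | 2 <= #|nbhd y :&: segment p q|].

Definition upper_bound_cond : Prop :=
  forall p q, 1 <= p -> p < q -> q <= n -> (p, q) <> (1, n) ->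
    #|Nin p q| <= q - p.

Definition lower_bound_cond : Prop :=
  forall (j : nat) (p q : 'I_j -> nat),
    1 <= j <= n.-1 ->
    (forall i, [&& 1 <= p i, p i < q i & q i <= n]) ->
    (forall i i' : 'I_j, i' = i.+1 :> nat -> q i <= p i') ->
    \sum_(i < j) (q i - p i) <= #|\bigcup_(i < j) Nmeet (p i) (q i)|.

Definition cardinality_cond : Prop :=
  #|Nin 1 n| = n /\ #|Nmeet 1 n| = n.

Definition property_A : Prop :=
  [/\ upper_bound_cond, lower_bound_cond & cardinality_cond].

End Graphs.

(* Main.v *)
Require Import Defs.
From mathcomp Require Import all_boot zify.

(** View each y as the interval [l y, r y] of positions of its neighbours; gap k
    lies between positions k and k+1.

    Given a Hamiltonian cycle, if the neighbours of A all lie in B then the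
    successor map embeds A into B; equality of cardinals would make A and B fill
    the whole cycle, which gives the upper bound.  Applied to the maximal runs
    of gaps outside a union of segments, the upper bound limits the number of
    intervals avoiding that union, and the lower bound follows by complement.

    Conversely, let y0 be an interval of least right end among those starting
    at the leftmost position m.  Deleting m and y0 and truncating the other
    intervals preserves the upper bound.  By induction the remaining positions
    carry a Hamiltonian cycle in which any prescribed truncated interval z is
    adjacent to m+1; replacing the edge z -- m+1 by the path z -- m -- y0 -- m+1
    gives a cycle in which both y0 and z are adjacent to m. *)

Set Implicit Arguments.
Unset Strict Implicit.
Unset Printing Implicit Defensive.

(** * Inductive construction of the cycle *)

(* Positions below m have been deleted, so the interval of u now starts at
   [maxn m (l u)]. *)
Lemma interval_cycle (V : finType) (e : rel V) (f : nat -> V) (l r : V -> nat)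
    (d m : nat) (S : {set V}) (y : V) :
  symmetric e -> #|S| = d.+2 ->
  (forall u, u \in S -> maxn m (l u) < r u <= m + d.+1) ->
  (forall u k, u \in S -> m <= k -> l u <= k <= r u -> e (f k) u) ->
  (forall p q, m <= p -> p < q -> q <= m + d.+1 -> (p, q) <> (m, m + d.+1) ->
     #|[set u in S | p <= maxn m (l u) & r u <= q]| <= q - p) ->
  y \in S -> l y <= m ->
  exists s t, [/\ path e (f m) (rcons s (f m)),
    perm_eq (f m :: s) (map f (iota m d.+2) ++ enum S) &
    s = y :: t \/ s = rcons t y].
Proof.
move=> e_sym; elim: d m S y => [|d IHd] m S y cardS Sr Se Sub yS ly.
  have /card_gt0P[z] : 0 < #|S :\ y| by move: (cardsD1 y S); rewrite yS; lia.
  rewrite !inE => /andP[zNy zS].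
  have /andP[yr yn] := Sr y yS; have /andP[zr zn] := Sr z zS.
  exists [:: y; f m.+1; z], [:: f m.+1; z]; split; last by left.
    by rewrite /= [e y _]e_sym [e z _]e_sym !Se //; lia.
  have -> : S = [set y; z].
    apply/esym/eqP; rewrite eqEcard subUset !sub1set yS zS cardS cards2.
    by rewrite eq_sym zNy.
  have yz : perm_eq (enum [set y; z]) [:: y; z].
    apply: uniq_perm; rewrite ?enum_uniq //= ?inE 1?eq_sym ?zNy //.
    by move=> u; rewrite mem_enum !inE.
  rewrite /= perm_cons perm_sym.
  apply: perm_trans (_ : perm_eq _ [:: f m.+1; y; z]) _; first by rewrite perm_cons.
  exact: (permEl (perm_catCA [:: f m.+1] [:: y] [:: z])).
pose S1 := [set u in S | l u <= m].
have yS1 : y \in S1 by rewrite inE yS.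
(* The intervals outside [S1] start after [m], so the upper bound allows at most [d.+1] of them
   among the [d.+3] in [S]. *)
have S1gt : 1 < #|S1|.
  have le1 : #|S :\: S1| <= d.+1.
    apply: leq_trans (_ : m + d.+2 - m.+1 <= _); last lia.
    apply: leq_trans (Sub m.+1 (m + d.+2) _ _ _ _); try lia; last by case; lia.
    apply/subset_leq_card/subsetP=> u; rewrite !inE => /andP[+ uS].
    by rewrite uS /=; have := Sr u uS; lia.
  have := cardsID S1 S; have -> : S :&: S1 = S1.
    by apply/setIidPr/subsetP=> u; rewrite inE => /andP[].
  lia.
have [y0 + y0min] := @arg_minnP _ y (fun u => u \in S1) r yS1.
rewrite inE => /andP[y0S ly0].
(* The new cycle will have exactly [y0] and [z] next to [f m], so [z] is chosen to make [y] one of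
   the two. *)
have [z [zS lz zNy0 yz]] : exists z, [/\ z \in S, l z <= m, z != y0 & y = y0 \/ y = z].
  have [->|yNy0] := eqVneq y y0; last by exists y; split=> //; right.
  have /card_gt0P[z] : 0 < #|S1 :\ y0|.
    by move: (cardsD1 y0 S1); rewrite inE y0S ly0 /=; lia.
  by rewrite !inE => /and3P[zNy0 zS lz]; exists z; split=> //; left.
have cardS' : #|S :\ y0| = d.+2 by move: (cardsD1 y0 S); rewrite y0S; lia.
(* By minimality of [r y0], a further interval ending by [m.+1] would put two intervals between [m]
   and [m.+1], where only one is allowed. So truncation at [m.+1] leaves no degenerate interval. *)
have r_gt u : u \in S :\ y0 -> m.+1 < r u.
  rewrite !inE => /andP[uNy0 uS]; have ru := Sr u uS.
  rewrite ltnNge; apply/negP=> ru'.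
  have uS1 : u \in S1 by rewrite inE uS; lia.
  have le1 : #|[set v in S | m <= maxn m (l v) & r v <= m.+1]| <= m.+1 - m.
    by apply: Sub => //; [lia | case; lia].
  have : [set u; y0] \subset [set v in S | m <= maxn m (l v) & r v <= m.+1].
    rewrite subUset !sub1set !inE uS y0S ru' !leq_maxl /=.
    exact: leq_trans (y0min _ uS1) ru'.
  by move/subset_leq_card; rewrite cards2 uNy0; lia.
have Sr' u : u \in S :\ y0 -> maxn m.+1 (l u) < r u <= m.+1 + d.+1.
  by move=> uS'; have := r_gt u uS'; move: uS'; rewrite !inE => /andP[_ /Sr]; lia.
have Se' u k : u \in S :\ y0 -> m.+1 <= k -> l u <= k <= r u -> e (f k) u.
  by rewrite !inE => /andP[_ uS] mk; apply: Se => //; lia.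
have Sub' p q : m.+1 <= p -> p < q -> q <= m.+1 + d.+1 ->
    (p, q) <> (m.+1, m.+1 + d.+1) ->
    #|[set u in S :\ y0 | p <= maxn m.+1 (l u) & r u <= q]| <= q - p.
  move=> mp pq qn pqN.
  have [pm|pm] := ltnP m.+1 p.
    apply: leq_trans (Sub p q _ _ _ _); [|lia|lia|lia|by case; lia].
    apply/subset_leq_card/subsetP=> u; rewrite !inE.
    by move=> /and3P[/andP[_ ->]] pu -> /=; lia.
  have {pm mp} pE : p = m.+1 by lia.
  have {pqN} qn' : q < m + d.+2.
    rewrite ltn_neqAle; apply/andP; split; last lia.
    by apply/eqP=> qE; apply: pqN; rewrite pE qE; congr pair; lia.
  (* If [y0] ends by [q], it accounts for one unit of the bound for [(m, q)]. Otherwise no interval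
     of [S1] ends by [q], and truncation does not affect the count. *)
  have [r0q|r0q] := leqP (r y0) q.
    have := Sub m q (leqnn _); set A := [set u in S | _] => HA.
    have {HA} HA : #|A| <= q - m by apply: HA; [lia|lia|by case; lia].
    have y0A : y0 \in A by rewrite inE y0S r0q leq_maxl.
    have := cardsD1 y0 A; rewrite y0A => cA.
    apply: leq_trans (_ : #|A :\ y0| <= _); last lia.
    apply/subset_leq_card/subsetP=> u; rewrite !inE.
    by move=> /and3P[/andP[-> ->]] _ -> /=; lia.
  apply: leq_trans (Sub p q _ _ _ _); [|lia|lia|lia|by case; lia].
  apply/subset_leq_card/subsetP=> u; rewrite !inE.
  move=> /and3P[/andP[_ uS] _ uq]; rewrite uS uq /= andbT pE.
  case: (leqP (l u) m) => lu; last lia.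
  have uS1 : u \in S1 by rewrite inE uS lu.
  by have := y0min u uS1; lia.
have [||s [t [ps sS st]]] := IHd m.+1 (S :\ y0) z cardS' Sr' Se' Sub' _ _.
- by rewrite !inE zNy0.
- lia.
have permS : perm_eq (enum S) (y0 :: enum (S :\ y0)).
  apply: uniq_perm; rewrite ?enum_uniq //= ?mem_enum ?inE ?eqxx ?enum_uniq //.
  by move=> u; rewrite inE !mem_enum !inE; case: eqVneq => // ->.
have perm_new s' : perm_eq s' (y0 :: f m.+1 :: s) ->
    perm_eq (f m :: s') (map f (iota m d.+3) ++ enum S).
  move=> s's; rewrite [iota m _]/= [map _ _]/= cat_cons perm_cons.
  apply: perm_trans s's _.
  have : perm_eq (y0 :: f m.+1 :: s) (y0 :: (map f (iota m.+1 d.+2) ++ enum (S :\ y0))).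
    by rewrite perm_cons.
  move/perm_trans; apply.
  rewrite perm_sym.
  apply: perm_trans (_ : perm_eq _ (map f (iota m.+1 d.+2) ++ ([:: y0] ++ enum (S :\ y0)))) _.
    by rewrite perm_cat2l.
  by rewrite perm_catCA.
have r0 := Sr y0 y0S; have rz := Sr z zS.
have e0 : e (f m) y0 by apply: Se => //; lia.
have e1 : e (f m.+1) y0 by apply: Se => //; lia.
have ez : e (f m) z by apply: Se => //; lia.
(* According to whether [z] follows or precedes [f m.+1], the inserted path through [f m] and [y0]
   is read in one direction or the other. *)
case: st => sE; subst s.
- exists (z :: rcons (rcons t (f m.+1)) y0).
  have new : path e (f m) (rcons (z :: rcons (rcons t (f m.+1)) y0) (f m)).
    move: ps; rewrite /= ez /= => /andP[_ pt].
    by rewrite 2!rcons_path pt !last_rcons e1 e_sym e0.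
  have pm : perm_eq (z :: rcons (rcons t (f m.+1)) y0) (y0 :: f m.+1 :: z :: t).
    rewrite -rcons_cons perm_rcons perm_cons.
    by rewrite -rcons_cons perm_rcons.
  case: yz => ->.
    by exists (z :: rcons t (f m.+1)); split; [| exact: perm_new|right].
  by exists (rcons (rcons t (f m.+1)) y0); split; [| exact: perm_new|left].
- have new : path e (f m) (rcons (y0 :: f m.+1 :: rcons t z) (f m)).
    rewrite /= e0 [e y0 _]e_sym e1 /=; move: ps.
    by rewrite !rcons_path !last_rcons => /andP[-> _]; rewrite e_sym.
  exists (y0 :: f m.+1 :: rcons t z).
  case: yz => ->.
    by exists (f m.+1 :: rcons t z); split; [| exact: perm_new|left].
  by exists (y0 :: f m.+1 :: t); split; [| exact: perm_new|right].
Qed.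

(** * Counting along a Hamiltonian cycle *)

(** The successor map of the cycle is injective and sends [A] into [B]. *)
Lemma ham_card_leq (V : finType) (e : rel V) (c : seq V) (A B : {set V}) :
  ucycle e c -> (forall v, v \in c) ->
  (forall a v, a \in A -> e a v -> v \in B) -> #|A| <= #|B|.
Proof.
move=> /andP[ec Uc] cV AB.
rewrite -(card_imset _ (can_inj (prev_next Uc))).
apply/subset_leq_card/subsetP=> _ /imsetP[a aA ->].
exact: AB aA (next_cycle ec (cV a)).
Qed.

(* If |A| = |B| then both [next c] and [prev c] map A onto B, so A and B
   together are stable under [next c] and hence fill the whole cycle. *)
Lemma ham_card_lt (V : finType) (e : rel V) (c : seq V) (A B : {set V}) :
  symmetric e -> ucycle e c -> (forall v, v \in c) ->
  (forall a v, a \in A -> e a v -> v \in B) ->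
  B != set0 -> A :|: B != setT -> #|A| < #|B|.
Proof.
move=> e_sym /andP[ec Uc] cV AB /set0Pn[b bB] ABT.
rewrite ltnNge; apply: contra ABT => leBA.
have nextB : next c @: A = B.
  apply/eqP; rewrite eqEcard (card_imset _ (can_inj (prev_next Uc))) leBA andbT.
  by apply/subsetP=> _ /imsetP[a aA ->]; apply: AB aA (next_cycle ec (cV a)).
have prevB : prev c @: A = B.
  apply/eqP; rewrite eqEcard (card_imset _ (can_inj (next_prev Uc))) leBA andbT.
  apply/subsetP=> _ /imsetP[a aA ->]; apply: AB aA _.
  by rewrite e_sym; apply: prev_cycle ec (cV a).
have cl : fclosed (next c) (A :|: B).
  move=> u _ /eqP <-; rewrite !inE; apply/orP/orP=> -[].
  - by move=> uA; right; rewrite -nextB imset_f.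
  - by rewrite -prevB => /imsetP[a aA ->]; left; rewrite next_prev.
  - by move=> nA; right; rewrite -prevB -[u](prev_next Uc) imset_f.
  - rewrite -nextB => /imsetP[a aA] /(can_inj (prev_next Uc)) ->; by left.
apply/eqP/setP=> v; rewrite [RHS]inE -(closed_connect cl (x := b)) ?inE ?bB ?orbT //.
by rewrite (fconnect_cycle (cycle_next Uc)).
Qed.

(** The successor and the predecessor of [v] are two distinct neighbours. *)
Lemma ham_degree (V : finType) (e : rel V) (c : seq V) (v : V) :
  symmetric e -> ucycle e c -> 2 < size c -> v \in c -> 1 < #|nbhd e v|.
Proof.
move=> e_sym /andP[ec Uc] c2 vc; apply/card_gt1P.
exists (next c v), (prev c v); rewrite !inE [e v (prev _ _)]e_sym prev_cycle // next_cycle //.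
split=> //; apply/eqP=> npv.
(* With [v] rotated to the front, equality would identify the second and the last entry of a
   duplicate-free list of length at least three. *)
have [i t ct] := rot_to vc.
move: npv c2; rewrite -(next_rot i Uc) -(prev_rot i Uc) -(size_rot i) ct.
have: uniq (v :: t) by rewrite -ct rot_uniq.
case: t {ct} => [|a [|b t]] // /andP[vt Ut] + _.
rewrite /next /next_at eqxx prev_nth mem_head (memNindex vt) /= -last_nth => ab.
by move: Ut; rewrite ab /= mem_last.
Qed.

(** * Counting intervals inside a set of gaps *)

(** Strong induction on [m]: split off the maximal run of gaps of [G] ending at [m.-1]. A counted
    interval lies in this run or ends before it. *)
Lemma card_interval_subset (T : finType) (Y : {set T}) (l r : T -> nat)
    (n m : nat) (G : pred nat) :
  (forall y, y \in Y -> 0 < l y < r y) ->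
  (forall p q, 0 < p -> p < q -> q <= n -> (p, q) <> (1, n) ->
     #|[set y in Y | p <= l y & r y <= q]| <= q - p) ->
  (exists2 k, 0 < k < n & ~~ G k) -> m <= n ->
  #|[set y in Y | r y <= m & all G (index_iota (l y) (r y))]|
    <= \sum_(1 <= k < m) G k.
Proof.
move=> lr Sub [k0 k0n Gk0]; elim/ltn_ind: m => m IHm mn.
have [m0|m_gt0] := posnP m.
  rewrite m0 (_ : [set y in Y | _] = set0) ?cards0 //.
  apply/setP=> y; rewrite !inE; apply/negP=> /and3P[yY r0 _].
  by have := lr y yY; lia.
(* The run consists of the gaps from [p] to [m.-1]; it is empty when [p = m]. *)
have [p [p_gt0 pm Gp p1]] : exists p, [/\ 0 < p, p <= m,
    forall k, p <= k < m -> G k & p = 1 \/ ~~ G p.-1].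
  elim: m m_gt0 {IHm mn} => // -[_ _|m IHm _].
    by exists 1; split=> // [k|]; [lia|left].
  have [Gm|Gm] := boolP (G m.+1); last first.
    by exists m.+2; split=> // [k|]; [lia|right].
  have [//|p [p_gt0 pm Gp p1]] := IHm; exists p; split=> // [|k]; first lia.
  by have [->//|km] := eqVneq k m.+1; move=> ?; apply: Gp; lia.
have cardGp : \sum_(p <= k < m) G k = m - p.
  rewrite big_nat (eq_bigr (fun _ => 1)) => [|k /Gp -> //].
  by rewrite -big_nat sum_nat_const_nat muln1.
have cardp : #|[set y in Y | p <= l y & r y <= m]| <= m - p.
  have [pm'|pm'] := ltnP p m.
    (* The gap [k0] outside [G] rules out the excluded pair [(1, n)]. *)
    apply: Sub => // -[pE mE]; move: Gk0; rewrite Gp //; lia.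
  rewrite (_ : [set y in Y | _] = set0) ?cards0 //.
  apply/setP=> y; rewrite !inE; apply/negP=> /and3P[yY pl rm].
  by have := lr y yY; lia.
rewrite (big_cat_nat (n := p)) //= cardGp.
have split_sum : \sum_(1 <= k < p.-1) G k <= \sum_(1 <= k < p) G k.
  have [p2|p2] := ltnP 1 p; last by rewrite big_geq //; lia.
  by rewrite [X in _ <= X](big_cat_nat (n := p.-1)) //= ?leq_addr //; lia.
have IHp : #|[set y in Y | r y <= p.-1 & all G (index_iota (l y) (r y))]|
    <= \sum_(1 <= k < p.-1) G k by apply: IHm; lia.
apply: leq_trans (leq_add (leq_trans IHp split_sum) cardp).
apply: leq_trans (leq_card_setU _ _); apply/subset_leq_card/subsetP=> y.
rewrite !inE => /and3P[yY rm /[dup] Gy ->]; rewrite yY rm /= !andbT.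
have := lr y yY; case: p1 => [->|Gp1] lry; first by rewrite orbC; case/andP: lry => ->.
apply/orP; have [|rp] := leqP (r y) p.-1; first by left.
(* An interval straddling the start of the run would contain the gap [p.-1], which is not in [G]. *)
right; rewrite leqNgt; apply/negP=> lp.
move/negP: Gp1; apply; apply: (allP Gy); rewrite mem_index_iota; lia.
Qed.

Lemma sum_segment (n p q : nat) :
  0 < p -> \sum_(1 <= k < n) (p <= k < q) = minn n q - minn n p.
Proof.
move=> p_gt0; elim: n => [|[|n] IHn]; [by rewrite big_geq //; lia..|].
by rewrite big_nat_recr //= IHn; case: (boolP (p <= n.+1 < q)) => /=; lia.
Qed.

(** * Neighbourhoods as intervals, and the lower bound *)

Section ConvexIntervals.

Variables (V : finType) (e : rel V) (Y : {set V}) (n : nat) (x : 'I_n -> V).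
Hypothesis x_inj : injective x.

Lemma mem_segment (i : 'I_n) (p q : nat) :
  (x i \in segment x p q) = (p <= i.+1 <= q).
Proof. by rewrite /segment mem_imset // inE. Qed.

Lemma card_segment_leq (p q : nat) : 0 < p -> p <= q -> #|segment x p q| <= (q - p).+1.
Proof.
move=> p_gt0 pq; rewrite -[X in _ <= X]card_ord.
pose g (k : 'I_n) : 'I_(q - p).+1 := inord (k.+1 - p).
rewrite card_imset //.
rewrite -(card_in_imset (f := g)) ?max_card // => i j.
rewrite !inE => ip jp /(congr1 val); rewrite /= !inordK; try lia.
by move=> ij; apply: val_inj => /=; lia.
Qed.

(** The given ends may fall outside [1..n] and are clamped; two distinct neighbours keep the clamped
    ends apart. *)
Lemma convex_intervals :
  (forall y, y \in Y -> exists i j, nbhd e y = segment x i j) ->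
  (forall y, y \in Y -> 1 < #|nbhd e y|) ->
  exists l r : V -> nat, forall y, y \in Y ->
    0 < l y < r y /\ r y <= n /\ nbhd e y = segment x (l y) (r y).
Proof.
move=> convex deg.
have /fin_all_exists[lr lrP] : forall y, exists lr : nat * nat, y \in Y ->
    0 < lr.1 < lr.2 /\ lr.2 <= n /\ nbhd e y = segment x lr.1 lr.2.
  (* Outside [Y] the pair is a dummy value. *)
  move=> y; have [yY|_] := boolP (y \in Y); last by exists (0, 0).
  have [i [j ij]] := convex y yY; exists (maxn 1 i, minn n j) => _ /=.
  have /card_gt1P[u [v [+ + uv]]] := deg y yY; rewrite ij.
  move=> /imsetP[a + ua] /imsetP[b + vb]; rewrite !inE => ai bi.
  have ab : a <> b :> nat by move/val_inj => ab; rewrite ua vb ab eqxx in uv.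
  have /= := (ltn_ord a, ltn_ord b) => -[an bn] /=; split; first by lia.
  split; first lia.
  apply/setP=> w; apply/imsetP/imsetP=> -[k kP ->]; exists k => //.
    by move: kP; rewrite !inE; have := ltn_ord k; lia.
  by move: kP; rewrite !inE; have := ltn_ord k; lia.
by exists (fun y => (lr y).1), (fun y => (lr y).2).
Qed.

Variables (l r : V -> nat).
Hypothesis lrP : forall y, y \in Y ->
  0 < l y < r y /\ r y <= n /\ nbhd e y = segment x (l y) (r y).

Lemma NinE (p q : nat) : Nin e Y x p q = [set y in Y | p <= l y & r y <= q].
Proof.
apply/setP=> y; rewrite !inE; case: (boolP (y \in Y)) => //= yY.
have [lr [rn ->]] := lrP yY; apply/subsetP/andP=> [sub|[pl rq] u].
  have ln : (l y).-1 < n by lia.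
  have rn' : (r y).-1 < n by lia.
  have := sub (x (Ordinal ln)); have := sub (x (Ordinal rn')).
  by rewrite !mem_segment /=; lia.
by case/imsetP=> k; rewrite inE => kP ->; rewrite mem_segment; lia.
Qed.

(** The two ends of the common gap [k], at the ordinals [k.-1] and [k], are common vertices. *)
Lemma Nmeet_gap (p q k : nat) (y : V) :
  y \in Y -> l y <= k < r y -> p <= k < q -> y \in Nmeet e Y x p q.
Proof.
move=> yY lkr pkq; have [lr [rn nE]] := lrP yY; rewrite inE yY nE /=.
have k1n : k.-1 < n by lia.
have kn : k < n by lia.
apply/card_gt1P; exists (x (Ordinal k1n)), (x (Ordinal kn)).
rewrite 2!in_setI !mem_segment /=; split; [lia|lia|].
by apply/eqP=> /x_inj /(congr1 val) /=; lia.
Qed.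

Hypothesis cardY : #|Y| = n.
Hypothesis upper : upper_bound_cond e Y x.

(** A vertex of [Y] outside the union uses only gaps not covered by the segments, so the uncovered
    gaps bound the number of such vertices. *)
Lemma upper_bound_lower_bound : lower_bound_cond e Y x.
Proof.
move=> j p q jn pq pq_next.
have pq_mono (i i' : 'I_j) : i < i' -> q i <= p i'.
  case: i' => i' i'j /=; elim: i' i'j => // i' IH i'j ii'.
  have i'j' : i' < j by lia.
  have := pq_next (Ordinal i'j') (Ordinal i'j) erefl => le1.
  have [/val_inj iE|ne] := eqVneq (val i) (val (Ordinal i'j')); first by rewrite iE.
  have /= ne' := ne; have := IH i'j'; have := pq (Ordinal i'j').
  by move: ii' ne' => /=; lia.
pose K k := [exists i : 'I_j, p i <= k < q i].
(* Ordered segments share no gap, so each gap is counted at most once. *)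
have sumK : \sum_(i < j) (q i - p i) <= \sum_(1 <= k < n) K k.
  rewrite (eq_bigr (fun i => \sum_(1 <= k < n) (p i <= k < q i))); last first.
    by move=> i _; have pqi := pq i; rewrite sum_segment; lia.
  rewrite exchange_big /=; apply: leq_sum => k _.
  rewrite /K; case: existsP => [[i ki]|no]; last first.
    by rewrite big1 // => i _; case: (boolP (p i <= k < q i)) => // ki; case: no; exists i.
  rewrite (bigD1 i) //= ki big1 // => i' i'i.
  have := pq_mono i i'; have := pq_mono i' i; case: ltngtP i'i => //.
  - by case: (boolP (p i' <= k < q i')) => //=; lia.
  - by case: (boolP (p i' <= k < q i')) => //=; lia.
  - by move/val_inj->; rewrite eqxx.
have j_gt0 : 0 < j by lia.
set U := \bigcup_(i < j) _.
have avoid := @card_interval_subset _ Y l r n n (predC K).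
have {avoid} le1 : #|Y :\: U| <= \sum_(1 <= k < n) predC K k.
  apply: leq_trans (avoid _ _ _ (leqnn n)).
  - apply/subset_leq_card/subsetP=> y; rewrite !inE => /andP[yU yY].
    have [lr [rn _]] := lrP yY; rewrite yY rn /=; apply/allP=> k.
    rewrite mem_index_iota /= => lkr; apply/negP=> /existsP[i ki].
    by move/negP: yU; apply; apply/bigcupP; exists i => //; apply: Nmeet_gap lkr ki.
  - by move=> y /lrP[].
  - by move=> p' q' ? ? ? ?; rewrite -NinE; apply: upper.
  (* Since [j] is positive, the first gap of the first segment is covered. *)
  - have /= i0 := pq (Ordinal j_gt0); exists (p (Ordinal j_gt0)); first by lia.
    by rewrite /= negbK; apply/existsP; exists (Ordinal j_gt0); lia.
have sumN : \sum_(1 <= k < n) K k + \sum_(1 <= k < n) predC K k <= n.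
  rewrite -big_split /= (eq_bigr (fun _ => 1)) => [|k _]; last by case: (K k).
  by rewrite sum_nat_const_nat; lia.
have := cardsID U Y; have := subset_leq_card (subsetIr Y U).
by rewrite cardY; lia.
Qed.


End ConvexIntervals.

(** * The two directions of the equivalence *)

Lemma property_A_hamiltonian (V : finType) (e : rel V) (X Y : {set V})
    (n : nat) (x : 'I_n -> V) (l r : V -> nat) :
  symmetric e -> bipartition e X Y -> injective x -> X = [set x i | i : 'I_n] ->
  (forall y, y \in Y ->
     0 < l y < r y /\ r y <= n /\ nbhd e y = segment x (l y) (r y)) ->
  #|Y| = n -> upper_bound_cond e Y x -> 1 < n -> has_hamiltonian_cycle e.
Proof.
move=> e_sym [XY dXY _] x_inj XE lrP cardY upper n_gt1.
case: n n_gt1 x x_inj XE lrP cardY upper => [|[|d]] // _ x x_inj XE lrP cardY upper.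
pose f k := x (inord k.-1).
have fS (i : 'I_d.+2) : f i.+1 = x i by rewrite /f inord_val.
have sub p q : 0 < p -> p < q -> q <= d.+2 -> (p, q) <> (1, d.+2) ->
    #|[set y in Y | p <= l y & r y <= q]| <= q - p.
  by move=> *; rewrite -(NinE x_inj lrP); apply: upper.
(* Otherwise all [d.+2] intervals would avoid position 1, where the bound allows only [d]; for
   [d = 0] no interval fits at all. *)
have [y yY ly] : exists2 y, y \in Y & l y <= 1.
  apply/exists_inP; rewrite -[X in is_true X]negbK negb_exists_in.
  apply/negP=> /forall_inP l2.
  have YE : Y = [set y in Y | 2 <= l y & r y <= d.+2].
    apply/setP=> y; rewrite inE; case: (boolP (y \in Y)) => //= yY.
    by have := l2 y yY; have := lrP y yY; lia.
  have [d0|d_gt0] := posnP d.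
    have /card_gt0P[y yY] : 0 < #|Y| by rewrite cardY.
    by have := l2 y yY; have := lrP y yY; lia.
  have := sub 2 d.+2; rewrite -YE cardY => H.
  by have : d.+2 <= d.+2 - 2; [apply: H | lia].
have [|||s [t [ps sE _]]] :=
    @interval_cycle V e f l r d 1 Y y e_sym cardY _ _ _ yY ly.
- by move=> u /lrP; lia.
- move=> u k uY k1 lkr; have [lr [rn nE]] := lrP u uY.
  have kn : k.-1 < d.+2 by lia.
  rewrite e_sym; suff : f k \in nbhd e u by rewrite inE.
  have -> : f k = x (Ordinal kn) by rewrite -fS /= prednK.
  by rewrite nE mem_segment //=; lia.
- move=> p q p1 pq qd pqN; apply: leq_trans (sub p q p1 pq qd pqN).
  apply/subset_leq_card/subsetP=> u; rewrite !inE => /and3P[uY pu ->].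
  by rewrite uY andbT; have := lrP u uY; lia.
exists (f 1 :: s); split.
- by rewrite (perm_size sE) size_cat size_map size_iota -cardE cardY; lia.
- rewrite /ucycle /= ps -[_ && _]/(uniq (f 1 :: s)) (perm_uniq sE) cat_uniq enum_uniq andbT.
  apply/andP; split.
    rewrite map_inj_in_uniq ?iota_uniq // => a b; rewrite !mem_iota => aP bP.
    by move/x_inj/(congr1 val); rewrite /= !inordK; lia.
  apply/hasPn=> u; rewrite mem_enum => uY; apply/negP=> /mapP[k _ uE].
  by move: (disjointFl dXY uY); rewrite XE uE imset_f.
- move=> v; rewrite (perm_mem sE) mem_cat mem_enum.
  have : v \in X :|: Y by rewrite XY inE.
  rewrite inE => /orP[|->]; last by rewrite orbT.
  rewrite XE => /imsetP[i _ ->]; apply/orP; left; apply/mapP; exists i.+1 => //.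
  by rewrite mem_iota; have := ltn_ord i; lia.
Qed.

Theorem theorem5 (V : finType) (e : rel V) (X Y : {set V}) (n : nat)
    (x : 'I_n -> V) :
  convex_bipartite e X Y x ->
  has_hamiltonian_cycle e <-> property_A e Y x.
Proof.
move=> [[e_sym _ [V_gt0 _]] bip [x_inj XE convex]].
have [XY dXY eXY] := bip.
have eY y v : y \in Y -> e y v -> v \in X.
  by move=> yY /eXY; rewrite (disjointFl dXY yY) => /andP[].
have eX y v : y \in X -> e y v -> v \in Y.
  by move=> yX /eXY; rewrite (disjointFr dXY yX) yX orbF.
have cardX : #|X| = n by rewrite XE card_imset // card_ord.
(* With [n = 0] both sides would be empty, but the graph has a vertex. *)
have Y_gt0 : #|Y| = n -> 0 < n.
  move=> cardY; have := (leq_card_setU X Y).1; rewrite XY cardsT.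
  by rewrite cardX cardY; lia.
have n_gt1 l r : (forall y, y \in Y -> 0 < l y < r y /\ r y <= n /\
    nbhd e y = segment x (l y) (r y)) -> #|Y| = n -> 1 < n.
  move=> lrP cardY; have : 0 < #|Y| by rewrite cardY Y_gt0.
  by case/card_gt0P=> y /lrP; lia.
split=> [[c [c2 cu cV]]|[upper _ [cardin cardmeet]]].
  have deg y : y \in Y -> 1 < #|nbhd e y| by move=> _; apply: ham_degree (cV y).
  have [l [r lrP]] := convex_intervals convex deg.
  have cardY : #|Y| = n.
    rewrite -cardX; apply/eqP; rewrite eqn_leq.
    by rewrite (ham_card_leq cu cV eY) (ham_card_leq cu cV eX).
  have upper : upper_bound_cond e Y x.
    move=> p q p_gt0 pq qn pqN; rewrite -ltnS.
    apply: leq_trans (card_segment_leq x_inj p_gt0 (ltnW pq)).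
    apply: (ham_card_lt e_sym cu cV).
    - by move=> a v; rewrite inE => /andP[_ /subsetP sub] av; apply: sub; rewrite inE.
    - have pn : p.-1 < n by lia.
      by apply/set0Pn; exists (x (Ordinal pn)); rewrite mem_segment //=; lia.
    (* A position outside the segment: the last one if [p = 1], the first one otherwise. Its vertex
       shows that [Nin p q] and the segment do not fill the graph. *)
    - have [i ipq] : exists i : 'I_n, ~~ (p <= i.+1 <= q).
        have [p1|p1] := eqVneq p 1.
          have n1 : n.-1 < n by lia.
          exists (Ordinal n1) => /=; apply/negP=> ?; apply: pqN; rewrite p1.
          by congr pair; lia.
        have n0 : 0 < n by lia.
        by exists (Ordinal n0) => /=; lia.
      apply/eqP=> /setP/(_ (x i)); rewrite in_setU mem_segment // (negPf ipq).
      rewrite !inE orbF => /andP[xY _].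
      by move: (disjointFl dXY xY); rewrite XE imset_f.
  split=> //; first exact: (upper_bound_lower_bound x_inj lrP cardY upper).
  split; rewrite -[X in _ = X]cardY; apply: eq_card => y.
    rewrite (NinE x_inj lrP) inE; case: (boolP (y \in Y)) => //= yY.
    by have := lrP y yY; lia.
  apply/idP/idP=> [|yY]; first by rewrite inE => /andP[].
  by apply: (Nmeet_gap x_inj lrP yY (k := l y)); have := lrP y yY; lia.
have NinY : Nin e Y x 1 n = Y.
  apply/setP=> y; rewrite inE; case: (boolP (y \in Y)) => //= yY.
  apply/subsetP=> u; rewrite inE => /(eY _ _ yY); rewrite XE => /imsetP[i _ ->].
  by rewrite mem_segment //=.
have cardY : #|Y| = n by rewrite -NinY.
(* Equality of cardinals forces every vertex of [Y] to have two neighbours, as the interval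
   representation requires. *)
have NmeetY : Nmeet e Y x 1 n = Y.
  apply/eqP; rewrite eqEcard cardmeet cardY leqnn andbT.
  by apply/subsetP=> y; rewrite inE => /andP[].
have deg y : y \in Y -> 1 < #|nbhd e y|.
  rewrite -NmeetY inE => /andP[_ /leq_trans]; apply.
  exact/subset_leq_card/subsetIl.
have [l [r lrP]] := convex_intervals convex deg.
exact: (property_A_hamiltonian e_sym bip x_inj XE lrP cardY upper (n_gt1 _ _ lrP cardY)).
Qed.
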